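(* Let $A$ and $B$ be quadratic real division algebras of dimension at least four, and let $S:A\to A$ and $T:B\to B$ be planar maps. Then $$\operatorname{Mor}(A_S,B_T)=\{\varphi\in\operatorname{Mor}(A,B)\mid \varphi S=T\varphi\}.$$
   Context: An algebra is a finite-dimensional real vector space with a bilinear multiplication (not necessarily associative, commutative or unital). A subalgebra is a linear subspace closed under multiplication. A division algebra is an algebra $A$ in which $x\mapsto ax$ and $x\mapsto xa$ are bijective for every non-zero $a\in A$. An algebra $B$ is quadratic if it has an identity element $1_B\neq0$ and $1_B,x,x^2$ are linearly dependent for all $x\in B$. For a quadratic division algebra $B$, a linear map $T:B\to B$ is planar if it is invertible, $T(1_B)=1_B$, and every subalgebra of $B$ is invariant under $T$ (equivalently, $T$ is invertible, $T(1_B)=1_B$ and $T(x)\in\operatorname{span}\{1_B,x\}$ for all $x\in B$). The isotope $B_T$ is the vector space $B$ with multiplication $x\circ y=(Tx)(Ty)$. $\operatorname{Mor}(X,Y)$ denotes the set of non-zero algebra morphisms $X\to Y$, i.e. non-zero linear maps $\varphi$ with $\varphi(xy)=\varphi(x)\varphi(y)$ for all $x,y$ in $X$ (with respect to the multiplications of $X$ and $Y$). *)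

(* Defs.v *)
From HB Require Import structures.
From mathcomp Require Import all_boot all_order all_algebra.
From mathcomp Require Import sesquilinear.
From mathcomp Require Import classical_sets reals.

Set Implicit Arguments.
Unset Strict Implicit.
Unset Printing Implicit Defensive.

Import GRing.Theory.
Local Open Scope ring_scope.
Local Open Scope classical_set_scope.

(* Finite-dimensional, not necessarily associative, commutative or unital; the
   library's [falgType] is associative and unital, hence unsuitable here. *)
Record algebra (R : realType) := Algebra {
  alg_sort :> vectType R;
  alg_mul : {bilinear alg_sort -> alg_sort -> alg_sort} }.

Notation "x ** y" := (alg_mul _ x y)
  (at level 40, left associativity) : ring_scope.

Section Algebras.
Context {R : realType}.
Implicit Types A B : algebra R.

Definition is_subalgebra A (U : {vspace A}) : Prop :=
  forall x y : A, x \in U -> y \in U -> x ** y \in U.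

Definition is_division A : Prop :=
  forall a : A, a != 0 ->
    bijective (fun x : A => a ** x) /\ bijective (fun x : A => x ** a).

Definition is_identity A (e : A) : Prop :=
  forall x : A, e ** x = x /\ x ** e = x.

(* [free] is sensitive to repetitions, as linear independence of a family is:
   for example [:: e; e; e] is not free. *)
Definition is_quadratic A : Prop :=
  exists e : A, [/\ is_identity e, e != 0
    & forall x : A, ~~ free [:: e; x; x ** x]].

(* An identity element is unique, so the second clause says that [T] fixes
   the identity element. *)
Definition is_planar A (T : 'End(A)) : Prop :=
  [/\ bijective T,
      exists2 e : A, is_identity e & T e = e
    & forall U : {vspace A}, is_subalgebra U -> (T @: U <= U)%VS].

Section Isotope.
Variables (A : algebra R) (T : 'End(A)).

Definition isotope_mul (x y : A) : A := T x ** T y.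

Fact isotope_mul_bilinear : bilinear_for *:%R *:%R isotope_mul.
Proof.
split=> [y k x x' | x k y y']; rewrite /isotope_mul linearP.
  exact: linearPl.
exact: linearPr.
Qed.

HB.instance Definition _ :=
  bilinear_isBilinear.Build R A A A *:%R *:%R isotope_mul isotope_mul_bilinear.

Definition isotope : algebra R := @Algebra R A isotope_mul.

End Isotope.

Definition Mor A B : set 'Hom(A, B) :=
  [set phi : 'Hom(A, B) | phi != 0 /\ forall x y : A, phi (x ** y) = phi x ** phi y].

End Algebras.

Arguments is_identity {R} A e.
Arguments is_subalgebra {R} A U.
Arguments is_planar {R} A T.
Arguments isotope {R} A T.
Arguments Mor {R} A B.

(* Main.v *)
(** If [phi : A_S -> B_T] is a non-zero morphism, then [phi] is injective, and
    since [x] multiplied with [1] in [A_S], on either side, is [S x], the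
    element [u = T (phi 1)] satisfies
    [phi (S x) = u (T (phi x)) = (T (phi x)) u] and [u u = phi 1].
    Hence [u] commutes with the image of [T phi], whose dimension exceeds 2.
    In a quadratic division algebra the centralizer of a non-scalar element
    [u] is only [span (1, u)], so [u] is a scalar; as [T] fixes [1], also
    [phi 1 = u], and [u u = u] forces [u = 1].  Thus [phi S = T phi], and the
    rest is formal. *)

Require Import Defs.
From mathcomp Require Import all_boot all_order all_algebra.
From mathcomp Require Import ring.
From mathcomp Require Import classical_sets reals.

Import GRing.Theory.

Local Open Scope ring_scope.
Local Open Scope classical_set_scope.

(** Basis coordinates are linear forms that separate vectors. Linearity is spelled out as equations,
    ready for rewriting. *)
Lemma eq_linear_forms {K : fieldType} {V : vectType K} (x y : V) :
  (forall f : V -> K, {morph f : u v / u + v} -> {morph f : u / - u} ->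
    (forall a, {morph f : u / a *: u >-> a * u}) -> f x = f y) ->
  x = y.
Proof.
move=> eqf; rewrite (coord_vbasis (memvf x)) (coord_vbasis (memvf y)).
apply: eq_bigr => i _; rewrite (eqf (coord (vbasis fullv) i)) //.
- exact: linearD.
- exact: linearN.
- by move=> a u; rewrite linearZ.
Qed.

(* Linear identities between vectors become field identities under every
   linear form. *)
Ltac vector_field :=
  let f := fresh "f" in let fD := fresh "fD" in
  let fN := fresh "fN" in let fZ := fresh "fZ" in
  apply: eq_linear_forms => f fD fN fZ; rewrite !(fD, fN, fZ); field.

Lemma identity_unique {R : realType} {A : algebra R} {e f : A} :
  is_identity A e -> is_identity A f -> e = f.
Proof. by move=> He Hf; rewrite -[LHS](Hf e).1 (He f).2. Qed.

Lemma division_integral {R : realType} {A : algebra R} {x y : A} :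
  is_division A -> x ** y = 0 -> x != 0 -> y = 0.
Proof.
move=> divA xy0 /divA[/bij_inj injx _].
by apply: injx; rewrite xy0 linear0r.
Qed.

(** A scalar [x = c *: e] has square [c *: x]. Otherwise [e] and [x] are independent, so the
    dependence must involve [x ** x]. *)
Lemma quadratic_identity_sqr {R : realType} {A : algebra R} {e : A} :
  is_quadratic A -> is_identity A e ->
  e != 0 /\ forall x : A, exists a b : R, x ** x = a *: e + b *: x.
Proof.
move=> [f [idf f0 quad]] ide; rewrite (identity_unique ide idf).
split=> // x; have [/vlineP[c ->] | xNf] := boolP (x \in <[f]>%VS).
  exists 0, c; rewrite scale0r add0r linearZl_LR linearZr_LR /=.
  by rewrite (idf f).1.
have := quad x; rewrite (perm_free (Y := [:: x ** x; x; f])); last first.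
  by rewrite -(perm_rev [:: f; _; _]).
rewrite free_cons negb_and negbK free_cons span_seq1 xNf seq1_free f0 orbF.
rewrite span_cons span_seq1 => /memv_addP[_ /vlineP[b ->]].
by case=> _ /vlineP[a ->] ->; exists a, b; rewrite addrC.
Qed.

(* The constant [c] shifts [u] to [v = u - c] with [v (w - b) = k] scalar.  The
   quadratic equation of [v] reads [v (v - s) = r] with [r != 0], whence
   [k (v - s) = r (w - b)]. *)
Lemma commute_quadratic_division {R : realType} {A : algebra R} {e u w : A} :
  is_quadratic A -> is_division A -> is_identity A e ->
  u \notin <[e]>%VS -> u ** w = w ** u -> w \in (<[e]> + <[u]>)%VS.
Proof.
move=> quadA divA ide uNe uwC.
have [e0 sqr] := quadratic_identity_sqr quadA ide.
(* Polarization: as [u] and [w] commute, [(u + w) ** (u + w)] contains [u ** w] twice, and [sqr]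
   gives all three squares. *)
have [a [b [c uwE]]] : exists a b c : R, u ** w = a *: e + b *: u + c *: w.
  have [au [bu uE]] := sqr u; have [aw [bw wE]] := sqr w.
  have [a [b]] := sqr (u + w).
  rewrite linearDl !linearDr -uwC uE wE => uwE.
  exists (2^-1 * (a - au - aw)), (2^-1 * (b - bu)), (2^-1 * (b - bw)).
  move: (u ** w) uwE => p uwE.
  rewrite (_ : p = 2^-1 *: ((au *: e + bu *: u + p
      + (p + (aw *: e + bw *: w)))
      - (au *: e + bu *: u) - (aw *: e + bw *: w))); last by vector_field.
  by rewrite uwE; vector_field.
pose v := u - c *: e.
have vNe x : v != x *: e.
  apply: contraNneq uNe => /eqP; rewrite subr_eq -scalerDl => /eqP->.
  exact/memvZ/memv_line.
have v0 : v != 0 by have := vNe 0; rewrite scale0r.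
have [r [s vE]] := sqr v.
pose k := a + c * b.
have vwE : v ** (w - b *: e) = k *: e.
  rewrite linearBl !linearBr !linearZl_LR !linearZr_LR /= (ide w).1 (ide e).1.
  by rewrite (ide u).2 uwE /k; vector_field.
have vsE : v ** (v - s *: e) = r *: e.
  by rewrite linearBr linearZr_LR /= vE (ide v).2 addrK.
(* If [r = 0], cancelling [v] would make it the scalar [s *: e], against [vNe]. *)
have r0 : r != 0.
  apply: contraNneq (vNe s) => r0; apply/eqP/subr0_eq.
  by apply: (division_integral divA _ v0); rewrite vsE r0 scale0r.
(* Left multiplication by [v] turns both terms into [(k * r) *: e]. *)
have : k *: (v - s *: e) - r *: (w - b *: e) = 0.
  apply: (division_integral divA _ v0).
  rewrite linearBr !linearZr_LR /= vsE vwE.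
  by rewrite !scalerA mulrC subrr.
move/subr0_eq/esym/(congr1 ( *:%R r^-1)); rewrite scalerK // => /eqP.
rewrite subr_eq => /eqP->.
have eU : e \in (<[e]> + <[u]>)%VS := subvP (addvSl _ _) _ (memv_line e).
have uU : u \in (<[e]> + <[u]>)%VS := subvP (addvSr _ _) _ (memv_line u).
by rewrite rpredD ?rpredZ ?rpredB ?rpredZ.
Qed.

(** A non-scalar [u] would confine [W] to the span of [e] and [u], of dimension at most two. *)
Lemma quadratic_division_centralizer {R : realType} {A : algebra R} {e u : A}
    (W : {vspace A}) :
  is_quadratic A -> is_division A -> is_identity A e -> (2 < \dim W)%N ->
  (forall w, w \in W -> u ** w = w ** u) -> u \in <[e]>%VS.
Proof.
move=> quadA divA ide dimW Wcent; apply: contraTT dimW => uNe; rewrite -leqNgt.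
have /dimvS/leq_trans : (W <= <[e]> + <[u]>)%VS.
  by apply/subvP => w /Wcent; apply: commute_quadratic_division.
apply; apply: leq_trans (dimv_add_leqif _ _) _.
by rewrite !dim_vline -[2%N]/(1 + 1)%N leq_add ?leq_b1.
Qed.

Lemma planar_identity {R : realType} {A : algebra R} {T : 'End(A)} {e : A} :
  is_planar A T -> is_identity A e -> T e = e.
Proof. by move=> [_ [f idf Tf] _] /identity_unique /(_ idf) ->. Qed.

(** A nonzero [x] in the kernel has [S x != 0], so division writes any [z] as [S x ** S y]. This is
    the isotope product of [x] and [y], which [phi] kills. *)
Lemma isotope_mor_inj {R : realType} {A B : algebra R} {S : 'End(A)}
    {T : 'End(B)} {phi : 'Hom(A, B)} :
  is_division A -> bijective S ->
  Mor (isotope A S) (isotope B T) phi -> injective phi.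
Proof.
move=> divA bijS [phi0 phiM]; apply/lker0P; apply: contraNT phi0.
rewrite -vpick0 => x0; apply/eqP/lfunP => z; rewrite lfunE /=.
have phix : phi (vpick (lker phi)) = 0.
  by apply/eqP; rewrite -memv_ker memv_pick.
have Sx0 : S (vpick (lker phi)) != 0.
  by apply: contraNneq x0 => Sx; apply/eqP/(bij_inj bijS); rewrite Sx linear0.
have [[g _ gK] _] := divA _ Sx0; have [h _ hK] := bijS.
have := phiM (vpick (lker phi)) (h (g z)).
by rewrite /= /isotope_mul /= hK gK phix linear0 linear0l.
Qed.

Lemma isotope_mor_comm {R : realType} {A B : algebra R} {S : 'End(A)}
    {T : 'End(B)} {phi : 'Hom(A, B)} :
  is_quadratic A -> is_division A -> is_quadratic B -> is_division B ->
  (2 < \dim {:A})%N -> is_planar A S -> is_planar B T ->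
  Mor (isotope A S) (isotope B T) phi -> forall x, phi (S x) = T (phi x).
Proof.
move=> quadA divA quadB divB dimA planarS planarT morphi.
have [eA [idA eA0 _]] := quadA; have [eB [idB eB0 _]] := quadB.
have [bijS _ _] := planarS; have [bijT _ _] := planarT.
have injphi := isotope_mor_inj divA bijS morphi.
have [_ phiM] := morphi.
have SeA := planar_identity planarS idA.
have TeB := planar_identity planarT idB.
have mulSl x : phi (S x) = T (phi eA) ** T (phi x).
  by have := phiM eA x; rewrite /= /isotope_mul /= SeA (idA _).1.
have mulSr x : phi (S x) = T (phi x) ** T (phi eA).
  by have := phiM x eA; rewrite /= /isotope_mul /= SeA (idA _).2.
have /vlineP[c TphieA] : T (phi eA) \in <[eB]>%VS.
  apply: (quadratic_division_centralizer (limg (T \o phi)%VF)) => //.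
    rewrite limg_dim_eq //; apply/eqP.
    rewrite -subv0 (subv_trans (capvSr _ _)) //.
    rewrite subv0; apply/lker0P => x y; rewrite !comp_lfunE.
    by move/(bij_inj bijT)/injphi.
  by move=> _ /memv_imgP[x _ ->]; rewrite comp_lfunE -mulSl -mulSr.
have phieA : phi eA = c *: eB.
  by apply: (bij_inj bijT); rewrite TphieA linearZ /= TeB.
have c0 : c != 0.
  by apply: contraNneq eA0 => c0; apply/eqP/injphi;
    rewrite phieA c0 scale0r linear0.
(* This becomes [c *: eB = c *: (c *: eB)]; cancelling [c] yields [eB = c *: eB]. *)
have := mulSl eA.
rewrite SeA TphieA linearZl_LR /= (idB _).1 phieA => /(scalerI c0) eBE x.
by rewrite mulSl TphieA -eBE (idB _).1.
Qed.

Theorem proposition9 (R : realType) (A B : algebra R)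
    (quadA : is_quadratic A) (divA : is_division A)
    (quadB : is_quadratic B) (divB : is_division B)
    (dimA : (4 <= \dim {:A})%N) (dimB : (4 <= \dim {:B})%N)
    (S : 'End(A)) (T : 'End(B))
    (planarS : is_planar A S) (planarT : is_planar B T) :
  Mor (isotope A S) (isotope B T) =
    [set phi : 'Hom(A, B) | Mor A B phi /\ (phi \o S = T \o phi)%VF].
Proof.
apply/seteqP; split=> phi.
  move=> morphi; have comm := isotope_mor_comm quadA divA quadB divB
    (ltnW dimA) planarS planarT morphi.
  (* As [S] is onto, every product in [A] is an isotope product of preimages under [S]. *)
  have [phi0 phiM] := morphi; have [[h _ hK] _ _] := planarS.
  split; last by apply/lfunP => x; rewrite !comp_lfunE.
  split=> // x y; have := phiM (h x) (h y).
  by rewrite /= /isotope_mul /= -!comm !hK.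
move=> [[phi0 phiM] /lfunP comm]; split=> // x y.
have commE z : phi (S z) = T (phi z) by have := comm z; rewrite !comp_lfunE.
by rewrite /= /isotope_mul /= phiM !commE.
Qed.
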